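(* (a) A finite group $G$ is an Arnautov group if and only if $G$ is totally Taĭmanov. (b) Every simple Markov group is an Arnautov group.
   Context: Group topologies are not assumed Hausdorff unless stated. A continuous group isomorphism $f:(G,\tau)\to(H,\sigma)$ of topological groups is semitopological if there exist a topological group $(\widetilde G,\widetilde\tau)$ containing $G$ as a normal subgroup with $\widetilde\tau$ inducing $\tau$ on $G$, and an open continuous homomorphism $\widetilde f:(\widetilde G,\widetilde\tau)\to(H,\sigma)$ extending $f$. A group $G$ is an Arnautov group if for every pair of group topologies $\sigma\le\tau$ on $G$ such that $id_G:(G,\tau)\to(G,\sigma)$ is semitopological, one has $\sigma=\tau$. The Taĭmanov topology $T_G$ on a group $G$ is the group topology whose neighborhoods of $e_G$ have as a base the centralizers $c_G(F)$ of finite subsets $F\subseteq G$. A group $G$ is Taĭmanov if $T_G$ is the discrete topology (equivalently, some finite $F\subseteq G$ has $c_G(F)=\{e_G\}$), and totally Taĭmanov if $G/N$ is Taĭmanov for every normal subgroup $N$ of $G$. A group is Markov if the discrete topology is its only Hausdorff group topology.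
   Formalization: In (b), ''simple'' is taken as simple non-abelian: the cyclic groups of prime order are simple and Markov but not Taĭmanov, hence by (a) not Arnautov, so (b) fails exactly for abelian simple groups. *)

(* Defs.v *)
From HB Require Import structures.
From mathcomp Require Import all_boot all_fingroup.
From mathcomp Require Import all_classical topology.

Set Implicit Arguments.
Unset Strict Implicit.
Unset Printing Implicit Defensive.

Local Open Scope classical_set_scope.
Local Open Scope group_scope.

Record topology (T : choiceType) := Topology {
  opens :> set (set T);
  opensT : opens setT;
  opensI : setI_closed opens;
  opens_bigU : forall (I : Type) (f : I -> set T),
    (forall i, opens (f i)) -> opens (\bigcup_i f i) }.

(* A copy of [T] whose canonical topology is [tau]; it lets several topologies
   on the same group coexist. *)
Definition topologized (T : choiceType) (tau : topology T) : Type := T.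

Section Topologized.
Variables (T : choiceType) (tau : topology T).

HB.instance Definition _ := Choice.on (topologized tau).
HB.instance Definition _ := isOpenTopological.Build (topologized tau)
  (opensT tau) (@opensI _ tau) (@opens_bigU _ tau).

Lemma open_topologized : @open (topologized tau) = tau.
Proof. by []. Qed.

End Topologized.

Record group_topology (G : groupType) := GroupTopology {
  topology_of :> topology G;
  mulg_continuous : continuous
    (fun p : topologized topology_of * topologized topology_of =>
       ((p.1 : G) * (p.2 : G) : topologized topology_of));
  invg_continuous : continuous
    (fun x : topologized topology_of =>
       ((x : G)^-1 : topologized topology_of)) }.

Definition discrete (T : choiceType) (tau : topology T) : Prop :=
  forall U : set T, opens tau U.

Definition normal_subgroup (G : groupType) (N : set G) : Prop :=
  [/\ N 1,
      forall x y, N x -> N y -> N (x * y^-1)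
    & forall x y, N x -> N (x ^ y)].

Definition continuous_between (T U : choiceType) (tau : topology T)
    (sigma : topology U) (f : T -> U) : Prop :=
  continuous (f : topologized tau -> topologized sigma).

Definition open_map (T U : choiceType) (tau : topology T)
    (sigma : topology U) (f : T -> U) : Prop :=
  forall V : set T, opens tau V -> opens sigma (f @` V).

(* The overgroup containing [G] as a normal subgroup is given by an embedding
   [i] of [G] with normal range. *)
Definition semitopological (G H : groupType) (tau : group_topology G)
    (sigma : group_topology H) (f : {multiplicative G -> H}) : Prop :=
  [/\ bijective f, continuous_between tau sigma f
    & exists (G' : groupType) (tau' : group_topology G')
             (i : {multiplicative G -> G'}) (f' : {multiplicative G' -> H}),
        [/\ injective i,
            normal_subgroup (range i),
            tau = [set i @^-1` V | V in tau'] :> set (set G)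
          & [/\ continuous_between tau' sigma f',
                open_map tau' sigma f'
              & forall x, f' (i x) = f x]]].

Definition arnautov (G : groupType) : Prop :=
  forall sigma tau : group_topology G,
    sigma `<=` tau -> semitopological tau sigma idfun ->
    sigma = tau :> set (set G).

Definition centralizer (G : groupType) (F : set G) : set G :=
  [set x | forall y, F y -> commute x y].

Section Taimanov.
Variable G : groupType.

Definition taimanov_open (U : set G) : Prop :=
  forall x, U x -> exists2 F : set G,
    finite_set F & forall c, centralizer F c -> U (x * c).

Lemma taimanov_openT : taimanov_open setT.
Proof. by move=> x _; exists set0. Qed.

Lemma taimanov_openI : setI_closed taimanov_open.
Proof.
move=> A B oA oB x [/oA[E fE EA] /oB[F fF FB]].
exists (E `|` F); first by rewrite finite_setU.
by move=> c cEF; split; [apply: EA|apply: FB] => y ?; apply: cEF; [left|right].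
Qed.

Lemma taimanov_open_bigU (I : Type) (f : I -> set G) :
  (forall i, taimanov_open (f i)) -> taimanov_open (\bigcup_i f i).
Proof.
move=> of_ x [i _ /of_[F fF Ff]]; exists F => // c cF.
by exists i => //; exact: Ff.
Qed.

Definition taimanov_top : topology G :=
  Topology taimanov_openT taimanov_openI taimanov_open_bigU.

Lemma centralizerM (F : set G) x y :
  centralizer F x -> centralizer F y -> centralizer F (x * y).
Proof.
by move=> cx cy z Fz; rewrite /commute -mulgA (cy z Fz) !mulgA (cx z Fz).
Qed.

Lemma centralizerV (F : set G) x : centralizer F x -> centralizer F x^-1.
Proof.
move=> cx z Fz; apply: (mulgI x); rewrite mulgA mulgV mul1g.
by rewrite mulgA (cx z Fz) -mulgA mulgV mulg1.
Qed.

Lemma centralizerJ (F : set G) x y :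
  centralizer [set z ^ y | z in F] (x ^ y) <-> centralizer F x.
Proof.
split=> [cx z Fz|cx _ [z Fz <-]].
  have : commute (x ^ y) (z ^ y) by apply: cx; exists z.
  by rewrite /commute -!conjMg => /conjg_inj.
by rewrite /commute -!conjMg (cx z Fz).
Qed.

Lemma taimanov_nbhs (x : topologized taimanov_top) (A : set G) :
  nbhs x A <-> exists2 F : set G,
    finite_set F & forall c, centralizer F c -> A ((x : G) * c).
Proof.
rewrite nbhsE; split=> [[U [oU Ux] UA]|[F fF FA]].
  by have [F fF FU] := oU x Ux; exists F => // c /FU /UA.
exists [set (x : G) * c | c in centralizer F]; last by move=> _ [c /FA ? <-].
split; last by exists 1 => [y _|]; rewrite /commute ?mulg1 ?mul1g.
move=> _ [c cF <-]; exists F => // d dF.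
by exists (c * d); [exact: centralizerM|rewrite mulgA].
Qed.

Lemma taimanov_nbhs1 (A : set G) :
  nbhs (1 : topologized taimanov_top) A <->
  exists2 F : set G, finite_set F & centralizer F `<=` A.
Proof.
by rewrite taimanov_nbhs; split=> -[F fF FA]; exists F => // c /FA; rewrite mul1g.
Qed.

Lemma taimanov_mul_continuous : continuous
  (fun p : topologized taimanov_top * topologized taimanov_top =>
     ((p.1 : G) * (p.2 : G) : topologized taimanov_top)).
Proof.
move=> [x y] A /taimanov_nbhs /= [F fF FA].
exists ([set x * c | c in centralizer [set z ^ y^-1 | z in F]],
        [set y * c | c in centralizer F]).
  split; apply/taimanov_nbhs.
    by exists [set z ^ y^-1 | z in F]; [exact: finite_image|move=> c ?; exists c].
  by exists F => // c ?; exists c.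
move=> [_ _] [/= [c cF <-] [d dF <-]] /=.
have -> : x * c * (y * d) = x * y * (c ^ y * d).
  by rewrite conjgE !mulgA mulgK.
apply/FA/centralizerM => //; apply/(centralizerJ _ _ y^-1).
by rewrite conjgK.
Qed.

Lemma taimanov_inv_continuous : continuous
  (fun x : topologized taimanov_top => ((x : G)^-1 : topologized taimanov_top)).
Proof.
move=> x A /taimanov_nbhs [F fF FA]; apply/taimanov_nbhs.
exists [set z ^ (x : G) | z in F]; first exact: finite_image.
move=> c cF /=.
have -> : ((x : G) * c)^-1 = x^-1 * (c^-1 ^ x^-1).
  by rewrite conjgE invgK invgM mulKg.
apply/FA/(centralizerJ _ _ (x : G)); rewrite conjgKV; exact: centralizerV.
Qed.

Definition taimanov_topology : group_topology G :=
  GroupTopology taimanov_mul_continuous taimanov_inv_continuous.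

Definition taimanov : Prop := discrete taimanov_topology.

End Taimanov.

(* [coset_of N] consists of the cosets of [N] inside the normaliser of [N], so
   it is the whole quotient group when [N] is normal. *)
Definition totally_taimanov (G : finGroupType) : Prop :=
  forall N : {group G}, N <| [set: G]%SET -> taimanov (coset_of N).

Definition markov (G : groupType) : Prop :=
  forall tau : group_topology G,
    hausdorff_space (topologized tau) -> discrete tau.

Definition simple_group (G : groupType) : Prop :=
  (exists x : G, x <> 1) /\
  forall N : set G, normal_subgroup N -> N = [set 1] \/ N = setT.

Definition abelian_group (G : groupType) : Prop :=
  forall x y : G, commute x y.

(* Main.v *)
(* For a group topology tau let [core tau] be the intersection of the open
   neighbourhoods of 1; it is a normal subgroup.  If id : (G, tau) -> (G, sigma)
   is semitopological, then [G, core sigma] is contained in core tau, that is,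
   core sigma is central modulo core tau.  Conversely, if N <= Z are normal with
   [G, Z] <= N, then the identity from the topology with base the cosets of N to
   the one with base the cosets of Z is semitopological: extend it to the first
   projection of G x G, topologized by the cosets of the normal subgroup
   {(a, b) | b in Z, a in b N}.  A topology on a finite group is determined by
   its core, and a finite G / N is Taimanov iff its centre is trivial, which
   gives (a).  In a simple Markov group each core is trivial (and the topology
   discrete) or everything (and the topology indiscrete), and the inclusion of
   commutators rules out that only core sigma is everything. *)

Require Import Defs.
From HB Require Import structures.
From mathcomp Require Import all_boot all_fingroup.
From mathcomp Require Import all_classical topology.

Set Implicit Arguments.
Unset Strict Implicit.
Unset Printing Implicit Defensive.

Local Open Scope classical_set_scope.
Local Open Scope group_scope.

(** * Continuity, commutators and normal subgroups *)

Lemma continuous_betweenP (T U : choiceType) (tau : topology T)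
    (sigma : topology U) (f : T -> U) :
  continuous_between tau sigma f <->
  forall V, opens sigma V -> opens tau (f @^-1` V).
Proof. exact: continuousP. Qed.

Lemma commgM (G : groupType) (x y z : G) :
  [~ x, y * z] = [~ x, z] * [~ x, y] ^ z.
Proof. by rewrite !commgEl conjMg conjVg conjgM -mulgA mulKVg. Qed.

Section GroupMorphism.
Variables (G H : groupType) (f : {multiplicative G -> H}).

Lemma multiplicative1 : f 1 = 1.
Proof. by apply: (mulgI (f 1)); rewrite -gmulfM !mulg1. Qed.

Lemma multiplicativeV : {morph f : x / x^-1}.
Proof.
by move=> x; apply: (mulgI (f x)); rewrite -gmulfM !mulgV multiplicative1.
Qed.

Lemma multiplicativeR : {morph f : x y / [~ x, y]}.
Proof. by move=> x y; rewrite !commgEl !conjgE !gmulfM !multiplicativeV. Qed.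

End GroupMorphism.

Section NormalSubgroup.
Variables (G : groupType) (N : set G).
Hypothesis nN : normal_subgroup N.

Lemma normal_subgroup1 : N 1. Proof. by case: nN. Qed.

Lemma normal_subgroupV x : N x -> N x^-1.
Proof. by case: nN => N1 NB _ Nx; rewrite -[x^-1]mul1g; apply: NB. Qed.

Lemma normal_subgroupM x y : N x -> N y -> N (x * y).
Proof.
by case: nN => N1 NB _ Nx Ny; rewrite -[y]invgK; apply/NB/normal_subgroupV.
Qed.

Lemma normal_subgroupJ x y : N x -> N (x ^ y).
Proof. by case: nN => _ _; apply. Qed.

Lemma normal_subgroupMC x y : N (x * y) -> N (y * x).
Proof. by move/(normal_subgroupJ x); rewrite conjgE -mulgA mulKg. Qed.

(** The set is the preimage in [G] of the centre of the quotient by [N]. *)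
Lemma normal_subgroup_centerm : normal_subgroup [set x | forall g, N [~ g, x]].
Proof.
split=> [g|x y Zx Zy g|x y Zx g] /=.
- by rewrite commg1; apply: normal_subgroup1.
- rewrite commgM; apply: normal_subgroupM; last exact: normal_subgroupJ.
  have -> : [~ g, y^-1] = ([~ g, y] ^ y^-1)^-1.
    by rewrite -conjVg invgR !commgEl !conjgE !invgK !mulgA mulgV mul1g.
  exact/normal_subgroupV/normal_subgroupJ.
- by rewrite -[g](conjgKV y) -conjRg; apply: normal_subgroupJ.
Qed.

Lemma sub_normal_subgroup_centerm : N `<=` [set x | forall g, N [~ g, x]].
Proof.
move=> x Nx g /=; rewrite commgEr; apply: normal_subgroupM => //.
exact/normal_subgroupJ/normal_subgroupV.
Qed.

End NormalSubgroup.

(** * The core of a group topology *)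

Section Core.
Variables (G : groupType) (tau : group_topology G).

Lemma continuousM (Y : topologicalType) (f g : Y -> G) :
  continuous (f : Y -> topologized tau) ->
  continuous (g : Y -> topologized tau) ->
  continuous (fun y => f y * g y : topologized tau).
Proof.
move=> cf cg y.
apply: (@continuous2_cvg Y (topologized tau) (topologized tau) (topologized tau)
  (nbhs y) _ f g (fun a b => (a : G) * (b : G)) (f y) (g y) _ (cf y) (cg y)).
exact: (mulg_continuous (x := (f y, g y))).
Qed.

Lemma continuousV (Y : topologicalType) (f : Y -> G) :
  continuous (f : Y -> topologized tau) ->
  continuous (fun y => (f y)^-1 : topologized tau).
Proof.
move=> cf y.
exact: (@continuous_comp Y (topologized tau) (topologized tau) f
  (fun x => (x : G)^-1) y (cf y) (invg_continuous (x := f y))).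
Qed.

Lemma continuous_conjg (Y : topologicalType) (f g : Y -> G) :
  continuous (f : Y -> topologized tau) ->
  continuous (g : Y -> topologized tau) ->
  continuous (fun y => f y ^ g y : topologized tau).
Proof.
move=> cf cg; apply: continuousM; first exact: continuousV.
exact: continuousM.
Qed.

Lemma open_preimage (f : G -> G) (U : set G) :
  continuous (f : topologized tau -> topologized tau) ->
  opens tau U -> opens tau (f @^-1` U).
Proof. by move=> /continuousP cf oU; apply: cf. Qed.

Let cid : continuous (id : topologized tau -> topologized tau).
Proof. by move=> x; exact: cvg_id. Qed.

Let ccst (x : G) :
  continuous ((fun=> x) : topologized tau -> topologized tau).
Proof. exact: cst_continuous. Qed.

Lemma continuous_mulg (x : G) :
  continuous ((fun y => x * y) : topologized tau -> topologized tau).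
Proof. exact: (continuousM (@ccst x) cid). Qed.

Definition core : set G := [set x | forall U, opens tau U -> U 1 -> U x].

Lemma core_mulr U x n : opens tau U -> U x -> core n -> U (x * n).
Proof.
move=> oU Ux /(_ [set y | U (x * y)]); apply; last by rewrite /= mulg1.
by apply: (open_preimage (f := fun y => x * y)) => //; exact: continuous_mulg.
Qed.

Lemma normal_core : normal_subgroup core.
Proof.
split=> [//|x y cx cy U oU U1|x y cx U oU U1].
- apply: core_mulr => // [|V oV V1]; first exact: cx.
  apply: (cy [set y | V y^-1]); last by rewrite /= invg1.
  by apply: open_preimage => //; exact: continuousV cid.
- apply: (cx [set x | U (x ^ y)]); last by rewrite /= conj1g.
  apply: (open_preimage (f := fun x => x ^ y)) => //.
  exact: (continuous_conjg cid (@ccst y)).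
Qed.

Lemma core1_hausdorff : core = [set 1] -> hausdorff_space (topologized tau).
Proof.
move=> core1 p q pq; apply: contrapT => npq.
have : ~ core ((p : G)^-1 * q).
  rewrite core1 /= => pq1; apply: npq.
  by rewrite -[RHS](mulKVg (p : G)) pq1 mulg1.
apply=> U oU U1.
(* [d] is 1 at [(p, q)] and constantly [p^-1 * q] on the diagonal. If [p] and [q] cannot be
   separated, some diagonal point is close enough to [(p, q)] to put [p^-1 * q] into [U]. *)
pose d (z : topologized tau * topologized tau) : topologized tau :=
  (p : G)^-1 * (z.1 : G) * ((z.2 : G)^-1 * q).
have cd : continuous d.
  have cst x : continuous ((fun=> x) :
      topologized tau * topologized tau -> topologized tau).
    exact: cst_continuous.
  have cfst : continuous
      (fst : topologized tau * topologized tau -> topologized tau).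
    by move=> z; apply: cvg_fst.
  have csnd : continuous
      (snd : topologized tau * topologized tau -> topologized tau).
    by move=> z; apply: cvg_snd.
  exact: (continuousM (continuousM (cst _) cfst)
                      (continuousM (continuousV csnd) (cst _))).
have : nbhs (d (p, q)) U.
  apply: open_nbhs_nbhs; split => //.
  by rewrite /d /= mulVg mulVg mulg1.
move=> /(cd (p, q)) [[A B] /= [Ap Bq] ABU].
have [c [Ac Bc]] := pq _ _ Ap Bq.
by have := ABU (c, c) (conj Ac Bc); rewrite /= /d /= -mulgA mulKVg.
Qed.

End Core.

(** A set open for [tau] is a union of left cosets of [core tau], hence of the smaller [core sigma],
    whose cosets are open for [sigma]. *)
Lemma open_core_eq (G : groupType) (sigma tau : group_topology G) :
  sigma `<=` tau -> core sigma `<=` core tau -> opens sigma (core sigma) ->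
  sigma = tau :> set (set G).
Proof.
move=> st cst oc; apply/seteqP; split=> // U oU.
have -> : U = \bigcup_(x : {x | U x}) [set y | core sigma ((sval x)^-1 * y)].
  apply/seteqP; split=> [x Ux|y [[x Ux] _ /= cxy]].
    by exists (exist _ x Ux) => //=; rewrite mulVg; case: (normal_core sigma).
  by rewrite -[y](mulKVg x); apply: core_mulr oU Ux _; apply: cst.
apply: opens_bigU => -[x Ux] /=.
apply: (open_preimage (f := fun y => x^-1 * y)) => //.
exact: continuous_mulg.
Qed.

Lemma finite_core_open (G : finGroupType) (tau : group_topology G) :
  opens tau (core tau).
Proof.
rewrite -[X in X _]open_topologized openE => x cx /=.
have nbhs1 : nbhs (1 : topologized tau) (core tau).
  (* Each [y] outside the core is avoided by some open neighbourhood of 1; as [G] is finite, a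
     single neighbourhood avoids them all. *)
  have : \forall z \near (1 : topologized tau), forall y : G,
      ~ core tau y -> z <> y.
    apply: (@filter_forall _ G (fun y z => ~ core tau y -> z <> y)
                           (nbhs (1 : topologized tau))) => y.
    have [cy|] := pselect (core tau y); last first.
      move=> /existsNP[U /not_implyP[oU /not_implyP[U1 nUy]]].
      apply: (@filterS _ _ _ U); last exact: open_nbhs_nbhs.
      by move=> z Uz _ zy; apply: nUy; rewrite -zy.
    by apply: filterE => z.
  by apply: filterS => z zc; apply: contrapT => /zc.
have : nbhs x [set y | core tau ((x : G)^-1 * y)].
  by apply: (@continuous_mulg _ tau (x : G)^-1 x (core tau)); rewrite /= mulVg.
rewrite /interior /=; apply: filterS => y /= cy; rewrite -[y](mulKVg x).
exact: (normal_subgroupM (normal_core tau)).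
Qed.

(* The kernel of the open extension meets the normal subgroup [range i]
   trivially, hence commutes with it, so correcting an element of the overgroup
   by the kernel does not change its commutators with [range i]. *)
Lemma semitopological_core (G H : groupType) (tau : group_topology G)
    (sigma : group_topology H) (f : {multiplicative G -> H}) (g x : G) :
  semitopological tau sigma f -> core sigma (f x) -> core tau [~ g, x].
Proof.
move=> [/bij_inj injf _ [G' [tau' [i [f' [_ [_ _ nJ] tauE [_ of' f'i]]]]]]] cx.
move=> U; rewrite tauE => -[V oV <-] /=; rewrite multiplicative1 => V1.
(* [W] is an open neighbourhood of 1, so its image under the open map [f'] is one too and contains
   [f x]. The resulting [w] in [W] differs from [i x] by an element of the kernel. *)
pose W := [set w | V [~ i g, w]].
have oW : opens tau' W.
  apply: (open_preimage (f := fun w => [~ i g, w])) => //.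
  have cst y : continuous ((fun=> y) : topologized tau' -> topologized tau').
    exact: cst_continuous.
  have cid : continuous (id : topologized tau' -> topologized tau').
    by move=> w; exact: cvg_id.
  exact: (continuousM (continuousV (cst _)) (continuous_conjg (cst _) cid)).
have [|w Ww f'w] := cx _ (of' _ oW).
- by exists 1; rewrite ?multiplicative1 // /W /= commg1.
have kerC k a : f' k = 1 -> commute (i a) k.
  move=> k1; apply/commgP/eqP.
  have [b _ ib] : range i [~ i a, k].
    rewrite commgEl; have [c _ <-] := nJ (i a) k (ex_intro2 _ _ a I erefl).
    by exists (a^-1 * c) => //; rewrite gmulfM multiplicativeV.
  rewrite -ib -(multiplicative1 i); congr (i _); apply: injf.
  by rewrite -f'i ib multiplicative1 multiplicativeR k1 commg1.
pose k := (i x)^-1 * w.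
have k1 : f' k = 1 by rewrite gmulfM multiplicativeV f'w f'i mulVg.
move: Ww; rewrite /W /= -[w](mulKVg (i x)) -/k commgM.
rewrite (eqP (introT commgP (kerC k g k1))) mul1g -multiplicativeR.
by rewrite conjgE (kerC k _ k1) mulKg.
Qed.

(** * Coset topologies and the semitopological maps between them *)

Section CosetTopology.
Variables (G : groupType) (N : set G).

Definition coset_open (U : set G) : Prop := forall x n, U x -> N n -> U (x * n).

Lemma coset_openT : coset_open setT. Proof. by []. Qed.

Lemma coset_openI : setI_closed coset_open.
Proof. by move=> A B oA oB x n [Ax Bx] Nn; split; [exact: oA|exact: oB]. Qed.

Lemma coset_open_bigU (I : Type) (f : I -> set G) :
  (forall i, coset_open (f i)) -> coset_open (\bigcup_i f i).
Proof. by move=> of_ x n [i _ fx] Nn; exists i => //; exact: of_. Qed.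

Definition coset_top : topology G :=
  Topology coset_openT coset_openI coset_open_bigU.

Hypothesis nN : normal_subgroup N.

Lemma coset_nbhs (x : topologized coset_top) (A : set G) :
  nbhs x A <-> forall n, N n -> A ((x : G) * n).
Proof.
rewrite nbhsE; split=> [[U [oU Ux] UA] n Nn|NA]; first exact/UA/oU.
exists [set (x : G) * n | n in N]; last by move=> _ [n /NA ? <-].
split; last by exists 1; [exact: normal_subgroup1|rewrite mulg1].
move=> _ m [n Nn <-] Nm; exists (n * m); first exact: normal_subgroupM.
by rewrite mulgA.
Qed.

Lemma coset_mul_continuous : continuous
  (fun p : topologized coset_top * topologized coset_top =>
     ((p.1 : G) * (p.2 : G) : topologized coset_top)).
Proof.
move=> [x y] A /coset_nbhs /= NA.
exists ([set x * n | n in N], [set y * n | n in N]).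
  by split; apply/coset_nbhs => n; exists n.
move=> [_ _] [/= [n Nn <-] [m Nm <-]] /=.
have -> : x * n * (y * m) = x * y * (n ^ y * m) by rewrite conjgE !mulgA mulgK.
by apply: NA; apply: (normal_subgroupM nN) => //; exact: normal_subgroupJ.
Qed.

Lemma coset_inv_continuous : continuous
  (fun x : topologized coset_top => ((x : G)^-1 : topologized coset_top)).
Proof.
move=> x A /coset_nbhs NA; apply/coset_nbhs => n Nn /=.
have -> : ((x : G) * n)^-1 = x^-1 * (n^-1 ^ x^-1).
  by rewrite conjgE invgK invgM mulKg.
by apply: NA; apply: (normal_subgroupJ nN); exact: normal_subgroupV.
Qed.

Definition coset_topology : group_topology G :=
  GroupTopology coset_mul_continuous coset_inv_continuous.

End CosetTopology.

Section SemitopologicalCosets.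
Variables (G : groupType) (N Z : set G).
Hypotheses (nN : normal_subgroup N) (nZ : normal_subgroup Z).
Hypotheses (NZ : N `<=` Z) (ZN : forall g z, Z z -> N [~ g, z]).

Definition twisted_diag : set (G * G) :=
  [set p | Z p.2 /\ N (p.2^-1 * p.1)].

(** Conjugating by [(g, w)] with unrelated [g] and [w] changes the quotient of the coordinates by
    commutators with [b], which lie in [N] by [ZN]. *)
Lemma normal_twisted_diag : normal_subgroup twisted_diag.
Proof.
split=> [|[a b] [c d] [/= Zb Nab] [/= Zd Ncd]|[a b] [g w] [/= Zb Nab]].
- by split; [exact: normal_subgroup1|rewrite /= mulVg; exact: normal_subgroup1].
- split=> /=; first by apply: normal_subgroupM => //; exact: normal_subgroupV.
  (* Cycling [d] to the end splits the product into [b^-1 * a] and [c^-1 * d]. *)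
  rewrite invgM invgK -mulgA; apply: (normal_subgroupMC nN).
  rewrite -!mulgA mulgA; apply: (normal_subgroupM nN) => //.
  by rewrite -[c^-1 * d]invgK invgM invgK; apply: normal_subgroupV.
- split=> /=; first exact: normal_subgroupJ.
  have -> : (b ^ w)^-1 * a ^ g = [~ w, b] * ([~ g, b]^-1 * (b^-1 * a) ^ g).
    by rewrite !commgEl !conjgE !invgM !invgK !mulgA !mulgK.
  apply: (normal_subgroupM nN); first exact: ZN.
  apply: (normal_subgroupM nN); last exact: normal_subgroupJ.
  by apply: (normal_subgroupV nN); exact: ZN.
Qed.

Definition left_incl (x : G) : G * G := (x, 1).

Lemma left_inclM : {morph left_incl : x y / x * y}.
Proof. by move=> x y; congr (_, _); rewrite mulg1. Qed.

HB.instance Definition _ :=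
  isMultiplicative.Build G (G * G)%type left_incl left_inclM.

(** [twisted_diag] meets the left factor in [N] and projects onto [Z] under [fst]: the first fact
    gives the induced topology, the second that [fst] is continuous and open. *)
Lemma semitopological_cosets :
  semitopological (coset_topology nN) (coset_topology nZ) idfun.
Proof.
split.
- by exists id.
- by apply/continuous_betweenP => U oU x n Ux Nn; apply: oU => //; exact: NZ.
exists (G * G)%type, (coset_topology normal_twisted_diag), left_incl, fst.
split.
- by move=> x y [].
- split=> [|_ _ [x _ <-] [y _ <-]|_ [g w] [x _ <-]].
  + by exists 1.
  + by exists (x * y^-1); rewrite ?gmulfM ?multiplicativeV.
  + by exists (x ^ g) => //; congr (_, _); rewrite -[RHS]/(1 ^ w) conj1g.
- apply/seteqP; split=> [U oU|_ [V oV <-] x n Vx Nn].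
    (* This set has trace [U] on the left factor. It is open because [c * d^-1] lies in [N] for
       [(c, d)] in [twisted_diag]. *)
    exists [set p | U (p.1 * p.2^-1)]; last first.
      by apply/seteqP; split=> x /=; rewrite invg1 mulg1.
    move=> [a b] [c d] /= Uab [/= _ Ncd].
    have -> : a * c * (b * d)^-1 = a * b^-1 * (c * d^-1) ^ b^-1.
      by rewrite conjgE invgK invgM !mulgA mulgKV.
    by apply: oU => //; apply: normal_subgroupJ => //; apply: normal_subgroupMC.
  have := oV _ (n, 1) Vx; rewrite /= gmulfM; apply; split=> /=.
    exact: normal_subgroup1.
  by rewrite invg1 mul1g.
- split=> //.
    apply/continuous_betweenP => U oU [a b] [c d] /= Ua [/= Zd Ncd].
    apply: oU => //; rewrite -[c](mulKVg d); apply: normal_subgroupM => //.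
    exact: NZ.
  (* Right translation by [z] in [Z] lifts to translation by [(z, z)], an element of
     [twisted_diag]. *)
  move=> V oV _ z [[x b] Vxb <-] Zz; exists (x * z, b * z) => //.
  have := oV (x, b) (z, z) Vxb; apply; split=> //=.
  by rewrite mulVg; exact: normal_subgroup1.
Qed.

End SemitopologicalCosets.

(** The two coset topologies must agree, so [N] is open for the cosets of [Z]; containing 1, it
    contains [Z]. *)
Lemma arnautov_central_quotient (G : groupType) (N Z : set G) :
  arnautov G -> normal_subgroup N -> normal_subgroup Z -> N `<=` Z ->
  (forall g z, Z z -> N [~ g, z]) -> Z `<=` N.
Proof.
move=> arnG nN nZ NZ ZN z Zz.
have eqNZ := arnG _ _ _ (semitopological_cosets nN nZ NZ ZN).
have oN : opens (coset_topology nZ) N.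
  rewrite eqNZ; last by move=> U oU x n Ux Nn; apply: oU => //; exact: NZ.
  by move=> x n; apply: normal_subgroupM.
by rewrite -[z]mul1g; apply: oN => //; exact: normal_subgroup1.
Qed.

(** * Finite groups, then simple Markov groups *)

Lemma arnautov_totally_taimanov (G : finGroupType) :
  arnautov G -> totally_taimanov G.
Proof.
move=> arnG N nNG.
have nNx x : x \in 'N(N) by rewrite (fintype.subsetP (normal_norm nNG)) ?inE.
have nN : normal_subgroup [set x | x \in N].
  split=> [|x y|x y] /=; first exact: group1.
  - by move=> Nx Ny; rewrite groupM ?groupV.
  - by rewrite memJ_norm.
have ZN := arnautov_central_quotient arnG nN (normal_subgroup_centerm nN)
  (sub_normal_subgroup_centerm nN) (fun g z Zz => Zz g).
(* The whole finite quotient serves as [F]; its centralizer is the centre, trivial by [ZN]. *)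
move=> U x Ux; exists setT; first exact: finite_finset.
move=> c cc; suff -> : c = 1 by rewrite mulg1.
have [z nz cz] := cosetP c; rewrite {c}cz in cc *.
apply: coset_id; apply: ZN => g /=.
apply: coset_idr; first by rewrite groupR.
by rewrite morphR //; apply/eqP/commgP/commute_sym; exact: (cc (coset N g)).
Qed.

Lemma totally_taimanov_arnautov (G : finGroupType) :
  totally_taimanov G -> arnautov G.
Proof.
move=> ttG sigma tau st semi; have nN := normal_core tau.
have gN : group_set [set x | `[< core tau x >]]%SET.
  apply/group_setP; split=> [|x y]; rewrite !inE.
    exact: (normal_subgroup1 nN).
  exact: (normal_subgroupM nN).
pose N := group gN.
have NE x : (x \in N) <-> core tau x by rewrite inE asboolE.
have nNx x : x \in 'N(N).
  rewrite inE; apply/fintype.subsetP => _ /imsetP[y /NE cy ->].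
  by apply/NE; exact: (normal_subgroupJ nN).
have nNG : N <| [set: G]%SET
  by apply/andP; split; apply/fintype.subsetP => x _ //;
    rewrite finset.in_setT.
(* Discreteness gives [F] with trivial centralizer in the quotient by [N]. Modulo [N], elements of
   [core sigma] commute with everything, so they are trivial there. *)
have [//|F _ F1] := ttG N nNG [set 1] 1.
apply: open_core_eq => // [x cx|]; last exact: finite_core_open.
apply/NE/coset_idr => //; rewrite -[LHS]mul1g; apply: F1 => yb _.
have [y _ ->] := cosetP yb.
apply/commute_sym/commgP/eqP; rewrite -morphR //; apply: coset_id.
by apply/NE; apply: semitopological_core semi cx.
Qed.

(** Non-commutativity excludes the cyclic groups of prime order, which are simple and Markov but
    equal to their centre, hence not Arnautov. *)
Lemma simple_markov_arnautov (G : groupType) :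
  simple_group G -> ~ abelian_group G -> markov G -> arnautov G.
Proof.
move=> [_ simG] nabG mG sigma tau st semi.
have [sigma1|sigmaT] := simG _ (normal_core sigma).
  have dsigma := mG sigma (core1_hausdorff sigma1).
  by apply/seteqP; split=> // U _; exact: dsigma.
have [tau1|tauT] := simG _ (normal_core tau).
  case: nabG => x y; apply/commgP/eqP.
  suff: core tau [~ x, y] by rewrite tau1.
  by apply: semitopological_core semi _; rewrite sigmaT.
apply: open_core_eq => //; first by rewrite tauT.
by rewrite sigmaT; exact: opensT.
Qed.

Theorem corollary5p26 :
  (forall G : finGroupType, arnautov G <-> totally_taimanov G) /\
  (forall G : groupType,
     simple_group G -> ~ abelian_group G -> markov G -> arnautov G).
Proof.
split=> [G|]; last exact: simple_markov_arnautov.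
by split; [exact: arnautov_totally_taimanov|exact: totally_taimanov_arnautov].
Qed.
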